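(* Let $\mathfrak R\subseteq\mathfrak R(d_*,L_*,s_* )$ be a cubical iterated graph system with replacement graphs $G_m$, equipped with the flipping symmetries $\eta_{t_j}:=\eta_j|_{S(\mathfrak R)}$, $j=1,\dots,d_*$. Let $p\in(1,\infty)$ and $q=\frac{p}{p-1}$. Then there is a constant $C_{\mathrm{FB}}>0$, independent of $m\in\mathbb N$ and of the type $t$, such that for every $m\in\mathbb N$ there exists a flow basis $\mathcal F^{(m)}$ of $\widetilde G_m$ with \[ \mathcal E_q(\mathcal F^{(m)})\le C_{\mathrm{FB}}\cdot\mathcal E_q\!\left(I_{t,-}^{(m)},I_{t,+}^{(m)},G_m\right)\quad\text{for all types }t. \]
   Context: Graphs: $(V,E)$, $V$ finite non-empty, $E\subseteq V\times V$, $(x,y)\in E\Rightarrow(y,x)\notin E$; $\{x,y\}\in E$ means either orientation. Flows: an antisymmetric $F:V\times V\to\mathbb R$ ($F(x,y)=-F(y,x)$, $F(x,y)=0$ unless $\{x,y\}\in E$) is a flow from $A$ to $B$ (disjoint non-empty) if $\operatorname{div}F(x):=\sum_{\{x,y\}\in E}F(x,y)=0$ for $x\notin A\cup B$; unit if $\sum_{x\in A}\operatorname{div}F(x)=1$; $\mathcal E_q(F)=\sum_{\{x,y\}\in E}|F(x,y)|^q$ (each edge once); $\mathcal E_q(A,B,G)=\inf\{\mathcal E_q(F): F$ unit flow from $A$ to $B$ in $G\}$. IGS $\mathfrak R$: connected graph $G_1=(S,E)$, finite type set $\mathcal T$, surjective typing $\mathfrak t:E\to\mathcal T$, non-empty gluing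 rules $I_t\subseteq S\times S$; $I_{t,+}$, $I_{t,-}$ are the sets of first, resp. second, coordinates of $I_t$, and $I_{t,\star}^{(m)}=(I_{t,\star})^m$. With $W_m=S^m$, $[w]_k=w_1\cdots w_k$, replacement graphs $G_m=(W_m,E_m)$: $(w,v)\in E_{m+1}$ iff (1) $[w]_m=[v]_m$ and $(w_{m+1},v_{m+1})\in E$ (type $\mathfrak t(w_{m+1},v_{m+1})$), or (2) $([w]_m,[v]_m)\in E_m$ and $(w_{m+1},v_{m+1})\in I_{\mathfrak t([w]_m,[v]_m)}$ (type $\mathfrak t([w]_m,[v]_m)$). Mapping of IGS $\varphi:\mathfrak R\to\mathfrak R'$: graph mapping $G_1\to G'_1$ (edges to edges or collapsed) with (i) if $\varphi(w_1)=\varphi(v_1)$ for an edge of type $t$ then $\varphi(w_2)=\varphi(v_2)$ for $(w_2,v_2)\in I_t$; (ii) if $(w_1,v_1)\in E$ of type $t$ and $(\varphi(w_1),\varphi(v_1))\in E'$ of type $t'$ then $(\varphi(w_2),\varphi(v_2))\in I'_{t'}$ for $(w_2,v_2)\in I_t$; (iii) if $(w_1,v_1)\in E$ of type $t$ and $(\varphi(v_1),\varphi(w_1))\in E'$ of type $t'$ then $(\varphi(v_2),\varphi(w_2))\in I'_{t'}$ for $(w_2,v_2)\in I_t$. Isomorphism of IGS: graph isomorphism with it and its inverse mappings of IGS; sub-system: $S\subseteq S'$, same types, inclusion a mapping of IGS. Cubical IGS: for integers $d_*\ge1,s_*\ge1,L_*\ge3$, $\mathfrak R(d_*,L_*,s_*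 )$ has symbols $\{1,\dots,L_*\}^{d_*}\times\{\underline1,\dots,\underline{s_*}\}$ with coordinates $c_i$, sheet $s$; types $t_1,\dots,t_{d_*}$; $(w,v)$ edge of type $t_j$ iff $c_i(v)=c_i(w)$ ($i\neq j$), $c_j(v)=c_j(w)+1$; $(w,v)\in I_{t_j}$ iff $c_i(w)=c_i(v)$ ($i\ne j$), $(c_j(w),c_j(v))=(L_*,1)$, $s(w)=s(v)$. Sheet- and other-coordinate-preserving maps: $\eta_j: c_j\mapsto L_*+1-c_j$; $\alpha^+_{j,k}$ ($j\neq k$) swaps $c_j,c_k$; $\alpha^-_{j,k}$: $c_k\mapsto L_*+1-c_j$, $c_j\mapsto L_*+1-c_k$; $\mathcal G$ the set of these. Cubical IGS: sub-system $\mathfrak R\subseteq\mathfrak R(d_*,L_*,s_* )$ with (C1) for each $j$, every symbol with $c_i\in\{1,L_*\}$ ($i\neq j$) and sheet $\underline1$ (condition $(\ast_j)$) is in $S(\mathfrak R)$; (C2) if $w,v$ satisfy $(\ast_j)$, agree off coordinate $j$, $c_j(v)=c_j(w)+1$, then $(w,v)\in E(\mathfrak R)$; (C3) if $w,v$ satisfy $(\ast_j)$, agree off coordinate $j$, $(c_j(w),c_j(v))=(L_*,1)$, then $(w,v)\in I_{t_j}(\mathfrak R)$; (C4) each $\alpha\in\mathcal G$ restricts to an isomorphism of IGS $\mathfrak R\to\mathfrak R$. Flipping symmetries act on $W_m$ letterwise: $\eta(w_1\cdots w_m)=\eta(w_1)\cdots\eta(w_m)$. Flow basis: let $\mathcal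 L^{(m)}=\{I_{t,\star}^{(m)}:t\in\mathcal T,\star\in\{+,-\}\}$ (a set, so equal sets are identified). $\widetilde G_m$ has vertex set $W_m\cup\{v_L: L\in\mathcal L^{(m)},v\in L\}$ (new formal symbols $v_L$) and edges $E_m\cup\{\{v_L,v\}:L\in\mathcal L^{(m)},v\in L\}$; $\widetilde L=\{v_L:v\in L\}$. A flow basis is a collection $\mathcal F^{(m)}$ of flows in $\widetilde G_m$ with: (FB1) each member is a unit flow from $\widetilde L_1$ to $\widetilde L_2$ for some distinct $L_1,L_2\in\mathcal L^{(m)}$, and for each ordered pair of distinct $L_1,L_2$ there is exactly one such member, denoted $\mathcal F_{[L_1\to L_2]}$; (FB2) if $L\notin\{L_1,L_2\}$ then $\mathcal F_{[L_1\to L_2]}(v_L,v)=0$ for all $v\in L$; (FB3) if $L\notin\{L_1,L_2\}$ then for all $v\in L$, $\mathcal F_{[L\to L_1]}(v_L,v)=\mathcal F_{[L\to L_2]}(v_L,v)$ and $\mathcal F_{[L_1\to L]}(v,v_L)=\mathcal F_{[L_2\to L]}(v,v_L)$; (FB4) if $L_1=I^{(m)}_{t,\star}$ and $L_2=I^{(m)}_{t,-\star}$ then for all $v\in L_1$, $\mathcal F_{[L_1\to L_2]}(v_{L_1},v)=\mathcal F_{[L_1\to L_2]}(\eta_t(v),\eta_t(v)_{L_2})$ and $\mathcal F_{[L_1\to L_2]}(v_{L_1},v)=\mathcal F_{[L_2\to L_1]}(v,v_{L_1})$. Here $\eta_t$ is the given flipping symmetry of type $t$. $\mathcal E_q(\mathcal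 F^{(m)}):=\max\{\mathcal E_q(F):F\in\mathcal F^{(m)}\}$. *)

(* Defs.v *)
From HB Require Import structures.
From mathcomp Require Import all_boot all_order all_algebra.
From mathcomp Require Import all_classical all_reals all_analysis.
Set Implicit Arguments. Unset Strict Implicit. Unset Printing Implicit Defensive.
Import Order.TTheory GRing.Theory Num.Theory.
Local Open Scope ring_scope.


Definition undir {V : finType} (E : rel V) (x y : V) : bool := E x y || E y x.

Definition divF {R : realType} {V : finType} (E : rel V) (F : V -> V -> R)
  (x : V) : R := \sum_(y | undir E x y) F x y.

Definition is_flow {R : realType} {V : finType} (E : rel V) (F : V -> V -> R)
  (A B : {set V}) : Prop :=
  [/\ A != finset.set0, B != finset.set0 & [disjoint A & B]] /\
  [/\ (forall x y, F x y = - F y x),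
      (forall x y, ~~ undir E x y -> F x y = 0) &
      (forall x, x \notin A -> x \notin B -> divF E F x = 0)].

Definition is_unit_flow {R : realType} {V : finType} (E : rel V)
  (F : V -> V -> R) (A B : {set V}) : Prop :=
  is_flow E F A B /\ \sum_(x in A) divF E F x = 1.

(* E_q(F): each edge counted once (E is antisymmetric in our graphs) *)
Definition energy {R : realType} {V : finType} (E : rel V) (q : R)
  (F : V -> V -> R) : R :=
  \sum_(e : V * V | E e.1 e.2) (`|F e.1 e.2| `^ q).

(* E_q(A,B,G) = inf of energies of unit flows (+oo if there is none) *)
Definition Eq_inf {R : realType} {V : finType} (E : rel V) (q : R)
  (A B : {set V}) : \bar R :=
  ereal_inf [set (energy E q F)%:E | F in [set F | is_unit_flow E F A B]]%classic.

(* Iterated graph systems.  Symbols live in a carrier finType Sym, the  *)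
(* symbol set is a subset S.  The typing t : E -> T is given as a typed *)
(* edge relation ET t (each edge has exactly one type).                 *)

Record igs (Sym T : finType) := IGS {
  iS : {set Sym};
  iE : rel Sym;
  iET : T -> rel Sym;
  iI : T -> {set Sym * Sym} }.

Definition is_igs {Sym T : finType} (G : igs Sym T) : Prop :=
  [/\ iS G != finset.set0,
      (forall x y, iE G x y -> (x \in iS G) && (y \in iS G)),
      (forall x y, iE G x y -> ~~ iE G y x) &
      (forall x y, x \in iS G -> y \in iS G -> connect (undir (iE G)) x y)] /\
  [/\ (forall t x y, iET G t x y -> iE G x y),
      (forall x y, iE G x y -> exists! t, iET G t x y),
      (forall t, exists x y, iET G t x y) &
      (forall t, iI G t != finset.set0 /\
         forall p, p \in iI G t -> (p.1 \in iS G) && (p.2 \in iS G))].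

Definition igs_mapping {Sym Sym' T T' : finType} (G : igs Sym T)
  (G' : igs Sym' T') (phi : Sym -> Sym') : Prop :=
  [/\ (forall x, x \in iS G -> phi x \in iS G'),
      (forall x y, iE G x y ->
         phi x = phi y \/ iE G' (phi x) (phi y) \/ iE G' (phi y) (phi x)),
      (forall t w1 v1, iET G t w1 v1 -> phi w1 = phi v1 ->
         forall w2 v2, (w2, v2) \in iI G t -> phi w2 = phi v2),
      (forall t t' w1 v1, iET G t w1 v1 -> iET G' t' (phi w1) (phi v1) ->
         forall w2 v2, (w2, v2) \in iI G t -> (phi w2, phi v2) \in iI G' t') &
      (forall t t' w1 v1, iET G t w1 v1 -> iET G' t' (phi v1) (phi w1) ->
         forall w2 v2, (w2, v2) \in iI G t -> (phi v2, phi w2) \in iI G' t')].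

Definition igs_iso {Sym Sym' T T' : finType} (G : igs Sym T)
  (G' : igs Sym' T') (phi : Sym -> Sym') : Prop :=
  exists psi : Sym' -> Sym,
  [/\ (forall x, x \in iS G -> psi (phi x) = x),
      (forall y, y \in iS G' -> phi (psi y) = y),
      (forall x y, x \in iS G -> y \in iS G ->
         undir (iE G) x y = undir (iE G') (phi x) (phi y)),
      igs_mapping G G' phi &
      igs_mapping G' G psi].

Definition igs_sub {Sym T : finType} (G G' : igs Sym T) : Prop :=
  [/\ iS G \subset iS G',
      (forall t x y, iET G t x y -> iET G' t x y) &
      igs_mapping G G' id].

(* Replacement graphs G_m on W_m = S^m (words = m-tuples of symbols;   *)
(* words with a letter outside S are isolated non-vertices).           *)
(* Edges of type t are computed on reversed words (last letter first). *)

Fixpoint edgeRT {Sym T : finType} (G : igs Sym T) (t : T) (w v : seq Sym)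
  {struct w} : bool :=
  match w, v with
  | a :: w', b :: v' =>
      ((w' == v') && iET G t a b) || (edgeRT G t w' v' && ((a, b) \in iI G t))
  | _, _ => false
  end.

Definition inS {Sym T : finType} (G : igs Sym T) (w : seq Sym) : bool :=
  all (fun a => a \in iS G) w.

Definition Gm_edge {Sym T : finType} (G : igs Sym T) (m : nat)
  : rel (m.-tuple Sym) :=
  fun w v => [&& inS G w, inS G v & [exists t, edgeRT G t (rev w) (rev v)]].

Arguments Gm_edge {Sym T} G m _ _.

(* I_{t,+}, I_{t,-}, and their m-th powers; b = true is '+' *)
Definition Iside {Sym T : finType} (G : igs Sym T) (t : T) (b : bool)
  : {set Sym} :=
  if b then [set p.1 | p in iI G t] else [set p.2 | p in iI G t].

Definition Ipow {Sym : finType} (m : nat) (X : {set Sym}) : {set m.-tuple Sym} :=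
  [set w : m.-tuple Sym | all (fun a => a \in X) w].

Definition Lset {Sym T : finType} (G : igs Sym T) (m : nat)
  : {set {set m.-tuple Sym}} :=
  [set Ipow m (Iside G t b) | t : T, b : bool].

(* the augmented graph \tilde G_m; the vertex v_L is inr (L, v) *)
Definition Vt (Sym : finType) (m : nat) : finType :=
  (m.-tuple Sym + ({set m.-tuple Sym} * m.-tuple Sym))%type.

Definition Gt_edge {Sym T : finType} (G : igs Sym T) (m : nat)
  : rel (Vt Sym m) :=
  fun x y => match x, y with
  | inl w, inl v => Gm_edge G m w v
  | inr (L, v), inl v' => [&& L \in Lset G m, v \in L & v == v']
  | _, _ => false
  end.

Arguments Gt_edge {Sym T} G m _ _.

Definition tildeL {Sym : finType} (m : nat) (L : {set m.-tuple Sym})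
  : {set Vt Sym m} := [set (inr (L, v) : Vt Sym m) | v in L].

Definition eta_word {Sym : finType} (m : nat) (f : Sym -> Sym)
  (w : m.-tuple Sym) : m.-tuple Sym := map_tuple f w.

(* Flow basis, indexed by ordered pairs (L1, L2): FB L1 L2 = F_[L1 -> L2].
   eta t is the flipping symmetry of type t. *)
Definition is_flow_basis {R : realType} {Sym T : finType} (G : igs Sym T)
  (eta : T -> Sym -> Sym) (m : nat)
  (FB : {set m.-tuple Sym} -> {set m.-tuple Sym} -> Vt Sym m -> Vt Sym m -> R)
  : Prop :=
  let LS := Lset G m in
  [/\
      (forall L1 L2, L1 \in LS -> L2 \in LS -> L1 != L2 ->
         is_unit_flow (Gt_edge G m) (FB L1 L2) (tildeL L1) (tildeL L2)),
      (forall L1 L2 L, L1 \in LS -> L2 \in LS -> L \in LS -> L1 != L2 ->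
         L != L1 -> L != L2 ->
         forall v, v \in L -> FB L1 L2 (inr (L, v)) (inl v) = 0),
      (forall L1 L2 L, L1 \in LS -> L2 \in LS -> L \in LS ->
         L != L1 -> L != L2 ->
         forall v, v \in L ->
           FB L L1 (inr (L, v)) (inl v) = FB L L2 (inr (L, v)) (inl v) /\
           FB L1 L (inl v) (inr (L, v)) = FB L2 L (inl v) (inr (L, v))) &
      (forall t b,
         let L1 := Ipow m (Iside G t b) in
         let L2 := Ipow m (Iside G t (~~ b)) in
         L1 != L2 ->
         forall v, v \in L1 ->
           FB L1 L2 (inr (L1, v)) (inl v)
             = FB L1 L2 (inl (eta_word (eta t) v))
                        (inr (L2, eta_word (eta t) v)) /\
           FB L1 L2 (inr (L1, v)) (inl v) = FB L2 L1 (inl v) (inr (L1, v)))].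

Definition energy_FB {R : realType} {Sym T : finType} (G : igs Sym T)
  (m : nat) (q : R)
  (FB : {set m.-tuple Sym} -> {set m.-tuple Sym} -> Vt Sym m -> Vt Sym m -> R)
  : R :=
  \big[Num.max/0]_(p in finset.setX (Lset G m) (Lset G m) | p.1 != p.2)
     energy (Gt_edge G m) q (FB p.1 p.2).

(* Cubical IGS.  Coordinates are stored 0-based: c_i : 'I_L with value  *)
(* k standing for k+1 in {1..L}; the sheet 'I_s with value 0 = sheet 1. *)

Definition cSym (d L s : nat) : finType := ({ffun 'I_d -> 'I_L} * 'I_s)%type.

Definition cube_edge {d L s : nat} (j : 'I_d) (w v : cSym d L s) : bool :=
  [forall i, (i != j) ==> (v.1 i == w.1 i)] && (val (v.1 j) == (val (w.1 j)).+1).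

Definition cube_glue {d L s : nat} (j : 'I_d) (w v : cSym d L s) : bool :=
  [&& [forall i, (i != j) ==> (w.1 i == v.1 i)],
      val (w.1 j) == L.-1, val (v.1 j) == 0%N & w.2 == v.2].

Definition cubeR (d L s : nat) : igs (cSym d L s) 'I_d :=
  @IGS (cSym d L s) 'I_d [set: cSym d L s]
    (fun w v => [exists j, cube_edge j w v])
    (fun j => cube_edge j)
    (fun j => [set p | cube_glue j p.1 p.2]).

Definition rev_c {L : nat} (a : 'I_L) : 'I_L := rev_ord a.

Definition eta_c {d L s : nat} (j : 'I_d) (x : cSym d L s) : cSym d L s :=
  ([ffun i => if i == j then rev_c (x.1 i) else x.1 i], x.2).

Definition alphaP {d L s : nat} (j k : 'I_d) (x : cSym d L s) : cSym d L s :=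
  ([ffun i => if i == j then x.1 k else if i == k then x.1 j else x.1 i], x.2).

Definition alphaM {d L s : nat} (j k : 'I_d) (x : cSym d L s) : cSym d L s :=
  ([ffun i => if i == k then rev_c (x.1 j)
              else if i == j then rev_c (x.1 k) else x.1 i], x.2).

Definition sym_group {d L s : nat} (f : cSym d L s -> cSym d L s) : Prop :=
  (exists j, f = eta_c j) \/
  (exists j k, j != k /\ f = alphaP j k) \/
  (exists j k, j != k /\ f = alphaM j k).

Definition star {d L s : nat} (j : 'I_d) (x : cSym d L s) : bool :=
  [forall i, (i != j) ==> ((val (x.1 i) == 0%N) || (val (x.1 i) == L.-1))]
  && (val x.2 == 0%N).

Definition is_cubical {d L s : nat} (G : igs (cSym d L s) 'I_d)
  : Prop :=
  [/\ is_igs G &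
      igs_sub G (cubeR d L s)] /\
  [/\
      (forall j x, star j x -> x \in iS G),
      (forall j w v, star j w -> star j v ->
         (forall i, i != j -> w.1 i = v.1 i) -> w.2 = v.2 ->
         val (v.1 j) = (val (w.1 j)).+1 -> iE G w v),
      (forall j w v, star j w -> star j v ->
         (forall i, i != j -> w.1 i = v.1 i) -> w.2 = v.2 ->
         val (w.1 j) = L.-1 -> val (v.1 j) = 0%N -> (w, v) \in iI G j) &
      (forall f, sym_group f -> igs_iso G G f)].

(* Main.v *)
Require Import Defs.
From HB Require Import structures.
From mathcomp Require Import all_boot all_order all_algebra.
From mathcomp Require Import all_classical all_reals all_analysis.
From mathcomp Require Import perm lra zify.
Import Order.TTheory GRing.Theory Num.Theory.
Local Open Scope ring_scope.
Set Implicit Arguments.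
Unset Strict Implicit.
Unset Printing Implicit Defensive.

(* Fix a direction [j] and a nearly optimal unit flow between the two faces of
   type [j], with [j] chosen to minimise the energy. Averaging it with minus its
   image under the flip [eta_j] makes source and sink mirror images of each
   other. Folding the cube along the diagonal hyperplane [c_j = c_k] is a graph
   map whose fibres have at most two points; it fixes the face [(j, -)] and acts
   on [(j, +)] as the swap of the coordinates [j] and [k], so it turns the flow
   into one from [(j, -)] to [(k, +)], while the swap itself gives a flow from
   [(k, -)] to [(k, +)]. These flows form a tree joining [(j, -)] to every face,
   and the members of the basis are differences of such "potentials", which makes
   the compatibility conditions automatic. All operations cost a bounded factor
   in energy; the flow through the additional edges is controlled because the
   degrees of [G_m] are bounded uniformly in [m]. *)

(** * Flows and their energy on finite graphs *)

Section FlowCalculus.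
Context {R : realType} {V : finType}.
Implicit Types (E : rel V) (F H : V -> V -> R).

Definition edge_field E F : Prop :=
  (forall x y, F x y = - F y x) /\ (forall x y, ~~ undir E x y -> F x y = 0).

(* Ordered pairs are summed, so every edge is counted twice. *)
Definition total_energy (q : R) F : R := \sum_x \sum_y `|F x y| `^ q.

Definition push (phi : V -> V) F (x y : V) : R :=
  \sum_(x' | phi x' == x) \sum_(y' | phi y' == y) F x' y'.

Definition graph_map E (phi : V -> V) : Prop :=
  forall x y, undir E x y -> phi x = phi y \/ undir E (phi x) (phi y).

Lemma undirC E x y : undir E x y = undir E y x.
Proof. by rewrite /undir orbC. Qed.

Lemma divF_total E F x : edge_field E F -> divF E F x = \sum_y F x y.
Proof.
move=> [_ hE]; rewrite /divF [RHS](bigID (undir E x)) /=.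
by rewrite [X in _ + X]big1 ?addr0 // => y /hE.
Qed.

Lemma edge_fieldB E F H : edge_field E F -> edge_field E H ->
  edge_field E (fun x y => F x y - H x y).
Proof.
move=> [aF sF] [aH sH]; split=> x y; first by rewrite aF aH; lra.
by move=> nE; rewrite sF // sH // subr0.
Qed.

Lemma edge_fieldZ E F (c : R) : edge_field E F ->
  edge_field E (fun x y => c * F x y).
Proof.
move=> [aF sF]; split=> x y; first by rewrite aF mulrN.
by move=> nE; rewrite sF // mulr0.
Qed.

Lemma divFB E F H x :
  divF E (fun x y => F x y - H x y) x = divF E F x - divF E H x.
Proof. by rewrite /divF sumrB. Qed.

Lemma divFZ E F (c : R) x : divF E (fun x y => c * F x y) x = c * divF E F x.
Proof. by rewrite /divF mulr_sumr. Qed.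

Lemma sum_antisym (P : pred V) F : (forall x y, F x y = - F y x) ->
  \sum_(x | P x) \sum_(y | P y) F x y = 0.
Proof.
move=> aF; set s := LHS; suff : s = - s by move=> h; lra.
rewrite {1}/s exchange_big -sumrN; apply: eq_bigr => y _.
by rewrite -sumrN; apply: eq_bigr => x _.
Qed.

Lemma sum_divF E F : edge_field E F -> \sum_x divF E F x = 0.
Proof.
move=> hF; under eq_bigr do rewrite divF_total //.
by apply: sum_antisym; case: hF.
Qed.

(** An edge collapsed by [phi] puts [F x y] and [F y x] on the same diagonal entry, where
    antisymmetry cancels them. *)
Lemma edge_field_push E phi F : graph_map E phi -> edge_field E F ->
  edge_field E (push phi F).
Proof.
move=> hphi [aF sF]; split=> x y.
  rewrite /push exchange_big -sumrN; apply: eq_bigr => y' _.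
  by rewrite -sumrN; apply: eq_bigr.
move=> nE; have [->|xy] := eqVneq x y; first exact: sum_antisym.
rewrite /push big1 // => x' /eqP hx; rewrite big1 // => y' /eqP hy.
apply: sF; apply/negP => /hphi; rewrite hx hy => -[exy|].
  by rewrite exy eqxx in xy.
by rewrite (negbTE nE).
Qed.

Lemma divF_push E phi F x : graph_map E phi -> edge_field E F ->
  divF E (push phi F) x = \sum_(x' | phi x' == x) divF E F x'.
Proof.
move=> hphi hF; rewrite divF_total; last exact: edge_field_push.
rewrite /push exchange_big; apply: eq_bigr => x' _.
rewrite divF_total // [RHS](partition_big phi xpredT) //.
Qed.

(** The fibre over [v] can meet the support of [f] only in [g v]. So the divergence of a folded flow
    depends only on how the fold acts on the faces carrying sources and sinks. *)
Lemma sum_fiber_support (phi g : V -> V) (f : V -> R) v : involutive g ->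
  (forall x, f x != 0 -> phi x = g x) -> \sum_(x | phi x == v) f x = f (g v).
Proof.
move=> hg hf; rewrite big_mkcond (bigD1 (g v)) //= big1 ?addr0 => [|x ne].
  case: eqP => // ne; have [-> //|/hf e] := eqVneq (f (g v)) 0.
  by case: ne; rewrite e hg.
case: eqP => // e; have [-> //|/hf e'] := eqVneq (f x) 0.
by move: ne; rewrite -e e' hg eqxx.
Qed.

End FlowCalculus.

(** * Energy estimates and nearly optimal flows *)

Section Energy.
Context {R : realType} {q : R}.
Hypothesis q_gt0 : 0 < q.

(** Each term is at most the [q]-norm [s ^ (1/q)] of the family, so the sum is at most [n] times
    that norm. *)
Lemma powR_norm_sum_le (I : finType) (P : pred I) (a : I -> R) (n : nat) :
  (#|P| <= n)%N ->
  `|\sum_(i | P i) a i| `^ q <= n%:R `^ q * \sum_(i | P i) `|a i| `^ q.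
Proof.
move=> hn; set s := \sum_(i | P i) `|a i| `^ q.
have s0 : 0 <= s by apply: sumr_ge0 => i _; apply: powR_ge0.
have hq : q^-1 * q = 1 by rewrite mulVf // gt_eqF.
have -> : s = (s `^ q^-1) `^ q by rewrite -powRrM hq powRr1.
rewrite -powRM ?powR_ge0 //; apply: ge0_ler_powR; rewrite ?nnegrE ?mulr_ge0 ?powR_ge0 ?(ltW q_gt0) //.
apply: le_trans (ler_norm_sum _ _ _) _.
apply: (@le_trans _ _ (\sum_(i | P i) s `^ q^-1)).
  apply: ler_sum => i Pi.
  rewrite -[`|a i|]powRr1 // -(mulfV (lt0r_neq0 q_gt0)) powRrM.
  apply: ge0_ler_powR; rewrite ?nnegrE ?powR_ge0 ?invr_ge0 ?(ltW q_gt0) //.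
  by rewrite /s (bigD1 i) //= lerDl sumr_ge0 // => j _; apply: powR_ge0.
rewrite sumr_const -[s `^ _ *+ _]mulr_natl ler_wpM2r ?powR_ge0 // ler_nat; exact: hn.
Qed.

Lemma powR_normB_le (a b : R) :
  `|a - b| `^ q <= 2 `^ q * (`|a| `^ q + `|b| `^ q).
Proof.
have := @powR_norm_sum_le bool xpredT (fun i => if i then a else - b) 2.
by rewrite card_bool !big_bool /= normrN => ->.
Qed.

Context {V : finType}.
Implicit Types (E : rel V) (F H : V -> V -> R).

Lemma total_energy_ge0 F : 0 <= total_energy q F.
Proof. by do 2!(apply: sumr_ge0 => ? _); apply: powR_ge0. Qed.

Lemma energy_le_total E F : energy E q F <= total_energy q F.
Proof.
rewrite /total_energy pair_big /= /energy [leRHS](bigID (fun e => E e.1 e.2)) /=.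
by rewrite lerDl sumr_ge0 // => ? _; apply: powR_ge0.
Qed.

Lemma total_energy_le E F : edge_field E F ->
  total_energy q F <= 2 * energy E q F.
Proof.
move=> [aF sF]; rewrite /energy big_mkcond /=.
rewrite -(pair_big xpredT xpredT (fun x y => if E x y then `|F x y| `^ q else 0)) /=.
set s := (X in 2 * X); have -> : 2 * s = s + s by lra.
rewrite {2}/s exchange_big /s -big_split /=; apply: ler_sum => x _.
rewrite -big_split /=; apply: ler_sum => y _.
have [|nE] := boolP (undir E x y); last first.
  by rewrite sF // normr0 powR0 ?gt_eqF //; case: ifP; case: ifP; rewrite ?addr_ge0 ?powR_ge0.
rewrite /undir; case: ifP => _ /=.
  by move=> _; rewrite lerDl; case: ifP => _; rewrite ?powR_ge0.
by move=> ->; rewrite add0r aF normrN.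
Qed.

Lemma total_energyB F H :
  total_energy q (fun x y => F x y - H x y) <=
  2 `^ q * (total_energy q F + total_energy q H).
Proof.
rewrite /total_energy -big_split mulr_sumr; apply: ler_sum => x _ /=.
rewrite -big_split mulr_sumr; apply: ler_sum => y _; exact: powR_normB_le.
Qed.

Lemma total_energy_half F :
  total_energy q (fun x y => 2^-1 * F x y) <= total_energy q F.
Proof.
do 2!(apply: ler_sum => ? _); apply: ge0_ler_powR; rewrite ?nnegrE ?(ltW q_gt0) //.
rewrite normrM ger0_norm ?invr_ge0 //.
by rewrite ler_piMl // invf_le1 // ler1n.
Qed.

(** The hypothesis bounds every fibre by two points, so an entry of [push phi F] has at most four
    terms. An involution satisfies it with [psi := phi]. *)
Lemma total_energy_push (phi psi : V -> V) F :
  (forall x, x \in [:: phi x; psi (phi x)]) ->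
  total_energy q (push phi F) <= 4 `^ q * total_energy q F.
Proof.
move=> hphi.
have hc y : (#|[pred x | phi x == y]| <= 2)%N.
  apply: leq_trans (card_size [:: y; psi y]); apply: subset_leq_card.
  by apply/fintype.subsetP => x /eqP <-.
have -> : total_energy q F = \sum_x \sum_y
    \sum_(p : V * V | (phi p.1 == x) && (phi p.2 == y)) `|F p.1 p.2| `^ q.
  rewrite /total_energy [LHS](partition_big phi xpredT) //=.
  apply: eq_bigr => x _; rewrite [LHS]exchange_big.
  rewrite [LHS](partition_big phi xpredT) //=; apply: eq_bigr => y _.
  rewrite exchange_big pair_big //.
rewrite mulr_sumr; apply: ler_sum => x _; rewrite mulr_sumr; apply: ler_sum => y _.
rewrite /push pair_big; apply: powR_norm_sum_le.
apply: (@leq_trans (#|[pred a | phi a == x]| * #|[pred b | phi b == y]|)).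
  by rewrite -cardX; apply: subset_leq_card; apply/fintype.subsetP => p.
by apply: (@leq_mul _ _ 2 2).
Qed.

Lemma sum_powR_divF_le E F (n : nat) :
  (forall x, #|[pred y | undir E x y]| <= n)%N ->
  \sum_x `|divF E F x| `^ q <= n%:R `^ q * total_energy q F.
Proof.
move=> hn; rewrite mulr_sumr; apply: ler_sum => x _.
apply: le_trans (powR_norm_sum_le _ (hn x)) _.
rewrite ler_wpM2l ?powR_ge0 // [leRHS](bigID (undir E x)) /= lerDl.
by apply: sumr_ge0 => ? _; apply: powR_ge0.
Qed.

(** The bound [c] depends on the graph; it only serves to make the infimum positive, hence strictly
    smaller than its double. *)
Lemma unit_flow_energy_gt E (A B : {set V}) : exists2 c : R, 0 < c &
  forall F, is_unit_flow E F A B -> c <= energy E q F.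
Proof.
pose n := #|{: V * V}|.+1; pose k : R := n%:R `^ q.
have k0 : 0 < k by rewrite powR_gt0 // ltr0n.
exists (k^-1 / 2); first by rewrite divr_gt0 ?invr_gt0.
move=> F [[_ [aF sF _]] hu]; have hF : edge_field E F by [].
have : 1 <= k * total_energy q F.
  have <- : `|\sum_(x in A) divF E F x| `^ q = 1 by rewrite hu normr1 powR1.
  under [X in `|X|]eq_bigr do rewrite divF_total //.
  rewrite pair_big; apply: le_trans (@powR_norm_sum_le _ _ _ n _) _.
    by rewrite leqW // max_card.
  rewrite ler_wpM2l ?(ltW k0) // /total_energy pair_big /=.
  rewrite [leRHS](bigID (fun p => (p.1 \in A) && true)) /= lerDl.
  by apply: sumr_ge0 => ? _; apply: powR_ge0.
have := total_energy_le hF => h1 h2.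
rewrite ler_pdivrMr // -(ler_pM2l k0) divff ?gt_eqF // (le_trans h2) //.
by rewrite ler_pM2l // mulrC.
Qed.

Lemma near_optimal_flow E (A B : {set V}) : (exists F : V -> V -> R, is_unit_flow E F A B) ->
  exists2 F : V -> V -> R, is_unit_flow E F A B &
    ((energy E q F)%:E <= 2%:E * Eq_inf E q A B)%E.
Proof.
move=> [F0 hF0]; have [c c0 hc] := unit_flow_energy_gt E A B.
have cinf : (c%:E <= Eq_inf E q A B)%E.
  by apply: le_ereal_inf_tmp => _ [F hF <-]; rewrite lee_fin hc.
have infF0 : (Eq_inf E q A B <= (energy E q F0)%:E)%E.
  by apply: ereal_inf_lbound; exists F0.
move: cinf infF0; case e: (Eq_inf E q A B) => [r||] //.
rewrite !lee_fin => cr _.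
have : (ereal_inf [set (energy E q F)%:E | F in [set F : V -> V -> R | is_unit_flow E F A B]]%classic
   < (2 * r)%:E)%E.
  by rewrite -/(Eq_inf E q A B) e lte_fin; lra.
move=> /ereal_inf_lt [_ [F hF <-]] hlt; exists F => //.
by rewrite -EFinM ltW.
Qed.

End Energy.

(** * Unit flows along walks *)

Section PathFlow.
Context {R : realType} {V : finType} {E : rel V}.

Lemma path_flow (w : nat -> V) (n : nat) :
  (forall i, (i < n)%N -> undir E (w i) (w i.+1)) ->
  exists F : V -> V -> R, edge_field E F /\
    forall x, divF E F x = (x == w 0%N)%:R - (x == w n)%:R.
Proof.
elim: n => [|n IH] hw.
  exists (fun _ _ => 0); split=> [|x]; first by split=> // x y; rewrite oppr0.
  by rewrite subrr /divF big1.
have [i hi|F [hF hdiv]] := IH; first by apply: hw; apply: leqW.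
(* [e] carries one unit back from [w n.+1] to [w n], so subtracting it prolongs the walk by one
   step; it vanishes if the two vertices coincide. *)
pose e x y : R := ((x == w n.+1) && (y == w n))%:R - ((x == w n) && (y == w n.+1))%:R.
have he : edge_field E e.
  split=> x y; first by rewrite /e opprB ![(y == _) && _]andbC.
  rewrite /e => nE; have hn := hw n (leqnn _).
  case: andP => [[/eqP ex /eqP ey]|_].
    by rewrite undirC ex ey hn in nE.
  by case: andP => [[/eqP ex /eqP ey]|_]; [rewrite ex ey hn in nE|rewrite subrr].
exists (fun x y => F x y - e x y); split; first exact: edge_fieldB.
have sum_eq (b : bool) v : \sum_(y : V) (b && (y == v))%:R = b%:R :> R.
  by rewrite (bigD1 v) //= eqxx andbT big1 ?addr0 // => y /negbTE ->; rewrite andbF.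
by move=> x; rewrite divFB hdiv (divF_total _ he) /e sumrB !sum_eq; lra.
Qed.

Lemma path_unit_flow (A B : {set V}) (F : V -> V -> R) a b : [disjoint A & B] ->
  a \in A -> b \in B -> edge_field E F ->
  (forall x, divF E F x = (x == a)%:R - (x == b)%:R) -> is_unit_flow E F A B.
Proof.
move=> dAB aA bB [aF sF] hdiv; have bA : b \notin A.
  by apply: contraTN bB => bA; rewrite (disjointFr dAB).
split.
  split; split=> //; [by apply/set0Pn; exists a|by apply/set0Pn; exists b|].
  move=> x xA xB; rewrite hdiv; case: eqP => [xa|_]; first by rewrite xa aA in xA.
  by case: eqP => [xb|_]; [rewrite xb bB in xB|rewrite subrr].
under eq_bigr do rewrite hdiv.
rewrite sumrB (bigD1 a) //= eqxx big1 => [|x /andP[_ /negbTE ->] //].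
rewrite big1 ?subr0 ?addr0 // => x xA; case: eqP => // xb.
by rewrite -xb xA in bA.
Qed.

End PathFlow.

(** * Symmetries and global coordinates of replacement graphs *)

Definition turn {A : Type} (b : bool) (e : rel A) (x y : A) : bool :=
  if b then e y x else e x y.

(** [r t] tells whether edges of type [t] are reversed. Gluing pairs are reversed together with the
    edges of their type, so that [f] acts letterwise on every [G_m]. *)
Definition igs_symmetry {Sym T : finType} (G : igs Sym T) (f : Sym -> Sym)
    (tau : T -> T) (r : T -> bool) : Prop :=
  [/\ (forall x, x \in iS G -> f x \in iS G),
      (forall t x y, iET G t x y -> turn (r t) (iET G (tau t)) (f x) (f y)) &
      (forall t x y, (x, y) \in iI G t ->
         turn (r t) (fun a b => (a, b) \in iI G (tau t)) (f x) (f y))].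

Lemma eta_word_involutive (Sym : finType) (m : nat) (f : Sym -> Sym) :
  involutive f -> involutive (eta_word (m := m) f).
Proof. by move=> hf w; apply: val_inj; rewrite /= (mapK hf). Qed.

Section Symmetry.
Context {Sym T : finType} {G : igs Sym T} {f : Sym -> Sym}.
Context {tau : T -> T} {r : T -> bool}.
Hypothesis hf : igs_symmetry G f tau r.

Lemma edgeRT_map t w v : edgeRT G t w v ->
  turn (r t) (edgeRT G (tau t)) (map f w) (map f v).
Proof.
case: hf => _ hET hI; elim: w v => [|a w IH] [|b v] //=.
rewrite /turn; case/orP => [/andP[/eqP -> /hET]|/andP[/IH + /hI]]; rewrite /turn.
  by case: ifP => _ /= ->; rewrite eqxx.
by case: ifP => _ /= -> ->; rewrite orbT.
Qed.

Lemma inS_map w : inS G w -> inS G (map f w).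
Proof. by case: hf => hS _ _; rewrite /inS all_map; apply: sub_all => a /hS. Qed.

Lemma undir_eta_word m (x y : m.-tuple Sym) : undir (Gm_edge G m) x y ->
  undir (Gm_edge G m) (eta_word f x) (eta_word f y).
Proof.
wlog h : x y / Gm_edge G m x y => [hw|_].
  by case/orP => h; last rewrite undirC; apply: hw => //; rewrite /undir h.
move: h => /and3P[hx hy /existsP[t /edgeRT_map]]; rewrite !map_rev /turn.
case: ifP => _ e; rewrite /undir /Gm_edge /= !inS_map //=; apply/orP; [right|left];
  by apply/existsP; exists (tau t).
Qed.

Lemma graph_map_eta_word m : graph_map (Gm_edge G m) (eta_word f).
Proof. by move=> x y /undir_eta_word; right. Qed.

Lemma Iside_map t b a : a \in Iside G t b -> f a \in Iside G (tau t) (b (+) r t).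
Proof.
case: hf => _ _ hI; rewrite /Iside; case: b => /imsetP[[x y] /hI]; rewrite /turn /=.
  by case: ifP => _ h ->; [exact: (imset_f snd h)|exact: (imset_f fst h)].
by case: ifP => _ h ->; [exact: (imset_f fst h)|exact: (imset_f snd h)].
Qed.

Lemma Ipow_map m t b (w : m.-tuple Sym) : w \in Ipow m (Iside G t b) ->
  eta_word f w \in Ipow m (Iside G (tau t) (b (+) r t)).
Proof.
by rewrite !inE /= all_map; apply: sub_all => a; apply: Iside_map.
Qed.

End Symmetry.

(** * Cube symmetries and global coordinates of words *)

Section CubeMaps.
Context {d L s : nat}.
Implicit Types (i j k t : 'I_d) (x y a : cSym d L s).

Lemma cube_edgeP t x y : cube_edge t x y ->
  (forall i, i != t -> y.1 i = x.1 i) /\ y.1 t = (x.1 t).+1 :> nat.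
Proof.
by case/andP => /forallP h /eqP e; split=> // i /(implyP (h i)) /eqP.
Qed.

Lemma cube_glueP t x y : cube_glue t x y ->
  [/\ forall i, i != t -> y.1 i = x.1 i, x.1 t = L.-1 :> nat, y.1 t = 0%N :> nat
    & y.2 = x.2].
Proof.
case/and4P => /forallP h /eqP e1 /eqP e2 /eqP e3.
by split=> // i /(implyP (h i)) /eqP.
Qed.

Lemma cube_edge_inj t t' x y : cube_edge t x y -> cube_edge t' x y -> t = t'.
Proof.
move=> /cube_edgeP[_ e] /cube_edgeP[h _]; apply/eqP; apply: contraTT isT => ne.
by have := h _ ne => e'; move: e; rewrite e'; lia.
Qed.

Lemma cube_edge_asym t t' x y : cube_edge t x y -> ~~ cube_edge t' y x.
Proof.
move=> /cube_edgeP[_ e]; apply/negP => /cube_edgeP[h e'].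
have [tt'|ne] := eqVneq t t'; first by move: e'; rewrite -tt'; lia.
by have := h _ ne => e2; move: e; rewrite e2; lia.
Qed.

Lemma alphaPE j k x i : (alphaP j k x).1 i = x.1 (tperm j k i).
Proof.
rewrite ffunE; case: tpermP => [->|->|/eqP/negbTE -> /eqP/negbTE -> //].
  by rewrite eqxx.
by rewrite eqxx; case: eqP => // ->.
Qed.

Lemma eta_cE j x i :
  (eta_c j x).1 i = if i == j then rev_ord (x.1 i) else x.1 i.
Proof. by rewrite ffunE. Qed.

Lemma alphaP_involutive j k : involutive (@alphaP d L s j k).
Proof.
move=> [x sh]; congr (_, _); apply/ffunP => i.
by change ((alphaP j k (alphaP j k (x, sh))).1 i = x i); rewrite !alphaPE tpermK.
Qed.

Lemma eta_c_involutive j : involutive (@eta_c d L s j).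
Proof.
move=> [x sh]; congr (_, _); apply/ffunP => i.
by rewrite !ffunE /=; case: eqP => // _; rewrite /rev_c rev_ordK.
Qed.

Lemma alphaP_id j x : alphaP j j x = x.
Proof.
case: x => x sh; congr (_, _); apply/ffunP => i.
by rewrite ffunE /=; case: eqP => [->|].
Qed.

Lemma alphaP_diag j k x : x.1 j = x.1 k -> alphaP j k x = x.
Proof.
case: x => x sh /= e; congr (_, _); apply/ffunP => i.
by rewrite ffunE /=; do ?case: eqP => [->|_] //.
Qed.

Lemma alphaP_eta_c j k x : alphaP j k (eta_c k x) = eta_c j (alphaP j k x).
Proof.
congr (_, _); apply/ffunP => i.
change ((alphaP j k (eta_c k x)).1 i = (eta_c j (alphaP j k x)).1 i).
rewrite alphaPE !eta_cE alphaPE.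
by rewrite (canF_eq (tpermK j k)) tpermR.
Qed.

Lemma cube_edge_alphaP j k t x y : cube_edge t x y ->
  cube_edge (tperm j k t) (alphaP j k x) (alphaP j k y).
Proof.
case/cube_edgeP => h e; apply/andP; split; last by rewrite !alphaPE tpermK; apply/eqP.
apply/forallP => i; apply/implyP => ne; rewrite !alphaPE h //.
by rewrite (canF_eq (tpermK j k)).
Qed.

Lemma cube_edge_eta_c j t x y : cube_edge t x y ->
  turn (t == j) (cube_edge t) (eta_c j x) (eta_c j y).
Proof.
case/cube_edgeP => h e; rewrite /turn; case: ifP => tj; apply/andP; split.
- by apply/forallP => i; apply/implyP => ne; rewrite !eta_cE h.
- by rewrite !eta_cE tj /= e; apply/eqP; have := ltn_ord (y.1 t); rewrite e => h'; rewrite subnSK.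
- by apply/forallP => i; apply/implyP => ne; rewrite !eta_cE h.
- by rewrite !eta_cE tj; apply/eqP.
Qed.

(* Base-[L] value of the [t]-coordinates of a reversed word: the global
   [t]-coordinate of the corresponding cell in the grid of side [L ^ m]. *)
Fixpoint gcoord (t : 'I_d) (w : seq (cSym d L s)) : nat :=
  if w is a :: w' then (gcoord t w' * L + a.1 t)%N else 0%N.

(** Digits in base [L] are unique, so every letter of a word on the diagonal is itself on the
    diagonal of the cube. *)
Lemma gcoord_diag j k w : gcoord j w = gcoord k w ->
  forall a, a \in w -> a.1 j = a.1 k.
Proof.
elim: w => //= b w IH e a; have hj := ltn_ord (b.1 j); have hk := ltn_ord (b.1 k).
have eb : b.1 j = b.1 k.
  by apply: val_inj; have := congr1 (modn^~ L) e; rewrite !modnMDl !modn_small.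
rewrite inE => /predU1P[-> //|]; apply: IH.
move: e; rewrite eb => /addIn /eqP; rewrite eqn_pmul2r; first by move/eqP.
exact: leq_ltn_trans hj.
Qed.

Lemma gcoord_le j k w : (forall a, a \in w -> a.1 k <= a.1 j)%N ->
  (gcoord k w <= gcoord j w)%N.
Proof.
elim: w => //= b w IH h; apply: leq_add; last by apply: h; rewrite mem_head.
by rewrite leq_mul2r IH ?orbT // => a aw; apply: h; rewrite inE aw orbT.
Qed.

Lemma gcoord_eq0 j w : (forall a, a \in w -> a.1 j = 0%N :> nat) -> gcoord j w = 0%N.
Proof.
elim: w => //= b w IH h; rewrite h ?mem_head // IH // => a aw.
by apply: h; rewrite inE aw orbT.
Qed.

(* Reflects the half [c_j > c_k] of the cube onto the half [c_j <= c_k]. *)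
Definition fold_word (j k : 'I_d) m (w : m.-tuple (cSym d L s)) :
    m.-tuple (cSym d L s) :=
  if (gcoord k (rev w) < gcoord j (rev w))%N then eta_word (alphaP j k) w else w.

Lemma eta_word_diag j k m (w : m.-tuple (cSym d L s)) :
  gcoord j (rev w) = gcoord k (rev w) -> eta_word (alphaP j k) w = w.
Proof.
move/gcoord_diag => h; apply: val_inj => /=; rewrite map_id_in // => a aw.
by apply: alphaP_diag; apply: h; rewrite mem_rev.
Qed.

Lemma fold_word_fiber j k m (w : m.-tuple (cSym d L s)) :
  w \in [:: fold_word j k w; eta_word (alphaP j k) (fold_word j k w)].
Proof.
rewrite /fold_word; case: ifP => _; rewrite !inE ?eqxx //.
by rewrite (eta_word_involutive (alphaP_involutive j k)) eqxx orbT.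
Qed.

End CubeMaps.

(** * Faces, degrees and boundary paths of cubical systems *)

Section Cubical.
Context {d L s : nat} {G : igs (cSym d L s) 'I_d}.
Hypotheses (hL : (3 <= L)%N) (hG : is_cubical G).
Implicit Types (i j k t : 'I_d) (x y a : cSym d L s).

Lemma iET_cube t x y : iET G t x y -> cube_edge t x y.
Proof. by case: hG => [[_ [_ h _]] _]; apply: h. Qed.

Lemma iET_exists t : exists x y, iET G t x y.
Proof. by case: hG => [[[_ [_ _ h _]] _] _]; apply: h. Qed.

Lemma iET_iE t x y : iET G t x y -> iE G x y.
Proof. by case: hG => [[[_ [h _ _ _]] _] _]; apply: h. Qed.

Lemma iE_iET x y : iE G x y -> exists t, iET G t x y.
Proof. by case: hG => [[[_ [_ h _ _]] _] _] /h[t [? _]]; exists t. Qed.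

(** Mappings of IGS compare gluing rules only along an edge of the given type; surjectivity of the
    typing supplies one. *)
Lemma iI_cube t x y : (x, y) \in iI G t -> cube_glue t x y.
Proof.
have [a [b ab]] := iET_exists t.
case: hG => [[_ [_ _ [_ _ _ h _]]] _] /(h t t a b ab (iET_cube ab)).
by rewrite inE.
Qed.

(** An isomorphism preserves edges only up to orientation, but an edge of the ambient cube
    determines its own type and orientation, so the geometric action of [f] decides both. The gluing
    rules follow by applying the mapping conditions to one edge of type [t]. *)
Lemma iso_symmetry f tau r : igs_iso G G f ->
  (forall t x y, cube_edge t x y -> turn (r t) (cube_edge (tau t)) (f x) (f y)) ->
  igs_symmetry G f tau r.
Proof.
move=> [_ [_ _ hund [hS _ _ hI hI'] _]] hcube.
have hET t x y : iET G t x y -> turn (r t) (iET G (tau t)) (f x) (f y).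
  move=> xy; have := iET_iE xy => exy.
  have [[_ hES _ _] _] : is_igs G by case: hG => [[]].
  have /andP[xS yS] := hES _ _ exy.
  have : undir (iE G) (f x) (f y) by rewrite -hund // /undir exy.
  have := hcube _ _ _ (iET_cube xy); rewrite /turn.
  by case: ifP => _ c /orP[] /iE_iET[t' h']; have c' := iET_cube h';
    rewrite ?(cube_edge_inj c c') //; have := cube_edge_asym t' c; rewrite c'.
split=> // t x y xy; have [a [b ab]] := iET_exists t.
have := hET _ _ _ ab; rewrite /turn; case: ifP => _ h.
  exact: hI' _ _ _ _ ab h _ _ xy.
exact: hI _ _ _ _ ab h _ _ xy.
Qed.

Lemma eta_c_symmetry j : igs_symmetry G (eta_c j) id (fun t => t == j).
Proof.
apply: iso_symmetry => [|t x y]; last exact: cube_edge_eta_c.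
by case: hG => _ [_ _ _]; apply; left; exists j.
Qed.

Lemma alphaP_symmetry j k : igs_symmetry G (alphaP j k) (tperm j k) xpred0.
Proof.
have [<-|jk] := eqVneq j k.
  by split=> [x|t x y|t x y]; rewrite ?tperm1 ?perm1 /turn !alphaP_id.
apply: iso_symmetry => [|t x y]; last exact: cube_edge_alphaP.
by case: hG => _ [_ _ _]; apply; right; left; exists j, k.
Qed.

Lemma Iside_coord t b a : a \in Iside G t b ->
  a.1 t = (if b then L.-1 else 0%N) :> nat.
Proof.
by rewrite /Iside; case: b => /imsetP[[x y] /iI_cube/cube_glueP[_ h1 h2 _] ->].
Qed.

Lemma Ipow_coord m t b (w : m.-tuple (cSym d L s)) : w \in Ipow m (Iside G t b) ->
  forall a, a \in rev w -> a.1 t = (if b then L.-1 else 0%N) :> nat.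
Proof.
by rewrite inE => /allP h a; rewrite mem_rev => /h; apply: Iside_coord.
Qed.

(** A gluing edge is a carry in base [L]: the last letter drops from [L.-1] to [0] while the higher
    digits increase by one. *)
Lemma gcoord_edge t w v : edgeRT G t w v ->
  forall i, gcoord i v = (gcoord i w + (i == t))%N.
Proof.
elim: w v => [|a w IH] [|b v] //= /orP[/andP[/eqP -> /iET_cube/cube_edgeP[h e]]|].
  move=> i; have [->|ne] := eqVneq i t; first by rewrite e addn1 addnS.
  by rewrite h // addn0.
case/andP=> /IH e /iI_cube/cube_glueP[h e1 e2 _] i; rewrite e.
have [->|ne] := eqVneq i t; last by rewrite h // !addn0.
by rewrite e1 e2 mulnDl addn0 mul1n -addnA addn1 prednK // (ltn_trans _ hL).
Qed.

(** The difference of the two global coordinates changes by at most one along an edge, so no edge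
    jumps over the diagonal. *)
Lemma gcoord_undir m (x y : m.-tuple (cSym d L s)) j k :
  undir (Gm_edge G m) x y -> (gcoord k (rev x) < gcoord j (rev x))%N ->
  (gcoord j (rev y) <= gcoord k (rev y))%N -> gcoord j (rev y) = gcoord k (rev y).
Proof.
case/orP => /and3P[_ _ /existsP[t /gcoord_edge h]]; rewrite !h;
  by do 2!case: eqP => _; rewrite /=; lia.
Qed.

(** If only one endpoint is swapped, the other lies on the diagonal and is fixed by the swap; the
    image is then the swapped edge. *)
Lemma graph_map_fold_word m j k : graph_map (Gm_edge G m) (fold_word j k (m := m)).
Proof.
move=> x y xy; right; have hal := undir_eta_word (alphaP_symmetry j k).
rewrite /fold_word; case: ltnP => hx; case: ltnP => hy //; first exact: hal.
  by rewrite -(eta_word_diag (gcoord_undir xy hx hy)); apply: hal.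
rewrite undirC in xy.
by rewrite -(eta_word_diag (gcoord_undir xy hy hx)) undirC; apply: hal.
Qed.

Lemma fold_word_minus m j k (w : m.-tuple (cSym d L s)) :
  w \in Ipow m (Iside G j false) -> fold_word j k w = w.
Proof. by move=> /Ipow_coord h; rewrite /fold_word (gcoord_eq0 h). Qed.

Lemma fold_word_plus m j k (w : m.-tuple (cSym d L s)) :
  w \in Ipow m (Iside G j true) -> fold_word j k w = eta_word (alphaP j k) w.
Proof.
move=> /Ipow_coord h; have : (gcoord k (rev w) <= gcoord j (rev w))%N.
  by apply: gcoord_le => a aw; rewrite h //; have := ltn_ord (a.1 k); lia.
rewrite /fold_word leq_eqVlt => /orP[/eqP e|-> //].
by rewrite e ltnn eta_word_diag.
Qed.

Lemma Ipow_disjoint m t : (1 <= m)%N ->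
  [disjoint Ipow m (Iside G t false) & Ipow m (Iside G t true)].
Proof.
move=> m1; rewrite disjoint_subset; apply/fintype.subsetP => w /Ipow_coord h0.
apply/negP => /Ipow_coord h1.
have aw : tnth w (Ordinal m1) \in rev w by rewrite mem_rev mem_tnth.
by have := h0 _ aw; rewrite (h1 _ aw); lia.
Qed.

Let zeroL : 'I_L := Ordinal (ltnW (ltnW hL)).

(** A step inside a copy leaves only the sheet of the last letter free, and a gluing step determines
    the last letter; hence [s] candidates at every length. *)
Lemma out_neighbours t w : exists2 l : seq (seq (cSym d L s)),
  (size l <= s)%N & forall v, edgeRT G t w v -> v \in l.
Proof.
elim: w => [|a w [l hl IH]]; first by exists [::].
have [e|ne] := eqVneq (val (a.1 t)) L.-1.
  pose b : cSym d L s := ([ffun i => if i == t then zeroL else a.1 i], a.2).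
  exists [seq b :: v | v <- l]; first by rewrite size_map.
  case=> [|c v] //= /orP[/andP[_ /iET_cube/cube_edgeP[_]]|].
    by have := ltn_ord (c.1 t); rewrite e; lia.
  case/andP => /IH vl /iI_cube/cube_glueP[h _ e0 e2].
  suff -> : c = b by apply: map_f.
  case: c h e0 e2 => c sc /= h e0 ->; congr (_, _); apply/ffunP => i.
  by rewrite ffunE; case: eqP => [->|/eqP/h //]; apply: val_inj.
pose b (sh : 'I_s) : cSym d L s :=
  ([ffun i => if i == t then insubd zeroL (a.1 t).+1 else a.1 i], sh).
exists [seq b sh :: w | sh <- enum 'I_s]; first by rewrite size_map size_enum_ord.
case=> [|c v] //= /orP[/andP[/eqP <- /iET_cube/cube_edgeP[h e]]|].
  suff -> : c = b c.2 by apply: (map_f (fun sh => b sh :: w)); rewrite mem_enum.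
  case: c h e => c sc /= h e; congr (_, _); apply/ffunP => i.
  rewrite ffunE; case: eqP => [->|/eqP/h //]; apply: val_inj.
  by rewrite val_insubd -e ltn_ord.
by case/andP => _ /iI_cube/cube_glueP[_ /eqP]; rewrite (negbTE ne).
Qed.

Lemma degree_le m (x : m.-tuple (cSym d L s)) :
  (#|[pred y | undir (Gm_edge G m) x y]| <= d * (s + s))%N.
Proof.
have card_le (P : pred (m.-tuple (cSym d L s)))
    (f : m.-tuple (cSym d L s) -> seq (cSym d L s)) (l : seq (seq (cSym d L s))) :
    injective f -> (forall z, P z -> f z \in l) -> (#|P| <= size l)%N.
  move=> finj hP; rewrite cardE -(size_map f); apply: uniq_leq_size.
    by rewrite map_inj_uniq // enum_uniq.
  by move=> _ /mapP[y + ->]; rewrite mem_enum => /hP.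
have revinj : injective (fun y : m.-tuple (cSym d L s) => rev y).
  by move=> y z /(congr1 rev); rewrite !revK => /val_inj.
have out t : (#|[pred y : m.-tuple _ | edgeRT G t (rev x) (rev y)]| <= s)%N.
  have [l hl h] := out_neighbours t (rev x).
  by apply: leq_trans hl; apply: card_le revinj _ => y /h.
(* [eta_c t] reverses the edges of type [t], turning in-neighbours of [x] into out-neighbours of its
   mirror image. *)
have inn t : (#|[pred y : m.-tuple _ | edgeRT G t (rev y) (rev x)]| <= s)%N.
  have [l hl h] := out_neighbours t (map (eta_c t) (rev x)).
  apply: leq_trans hl; apply: (card_le _ (fun z => map (eta_c t) (rev z))).
    by move=> y z' /(inj_map (can_inj (eta_c_involutive t))) /revinj.
  move=> y /(edgeRT_map (eta_c_symmetry t)); rewrite /turn eqxx; exact: h.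
rewrite -sum1_card big_mkcond /=.
apply: (@leq_trans (\sum_(y : m.-tuple _) \sum_t
   (edgeRT G t (rev x) (rev y) + edgeRT G t (rev y) (rev x)))).
  apply: leq_sum => y _; case: ifP => //.
  by case/orP => /and3P[_ _ /existsP[t h]]; rewrite (bigD1 t) //= h; lia.
rewrite exchange_big -[d in (d * _)%N]card_ord -sum_nat_const; apply: leq_sum => t _.
rewrite big_split /=; apply: leq_add.
  apply: leq_trans (out t); rewrite -sum1_card [leqRHS]big_mkcond.
  by apply: leq_sum => y _; rewrite inE; case: edgeRT.
apply: leq_trans (inn t); rewrite -sum1_card [leqRHS]big_mkcond.
by apply: leq_sum => y _; rewrite inE; case: edgeRT.
Qed.

Hypothesis hs : (1 <= s)%N.

Let sheet0 : 'I_s := Ordinal hs.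

(** For extremal [e] these symbols satisfy [star t], so the cubical axioms provide them together
    with their edges and gluings. *)
Definition edge_symbol t (e c : 'I_L) : cSym d L s :=
  ([ffun i => if i == t then c else e], sheet0).

Lemma edge_symbol_coord t e c i :
  (edge_symbol t e c).1 i = if i == t then c else e.
Proof. by rewrite ffunE. Qed.

Definition extremal (e : 'I_L) : bool := (val e == 0%N) || (val e == L.-1).

Lemma edge_symbol_star t e c : extremal e -> star t (edge_symbol t e c).
Proof.
move=> he; rewrite /star eqxx andbT; apply/forallP => i; apply/implyP => ne.
by rewrite edge_symbol_coord (negbTE ne).
Qed.

Lemma edge_symbol_glue t e (c0 c1 : 'I_L) : extremal e ->
  val c0 = 0%N -> val c1 = L.-1 ->
  (edge_symbol t e c1, edge_symbol t e c0) \in iI G t.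
Proof.
move=> he h0 h1; case: hG => _ [_ _ h _]; apply: h; rewrite ?edge_symbol_star //.
- by move=> i ne; rewrite !edge_symbol_coord (negbTE ne).
- by rewrite edge_symbol_coord eqxx.
- by rewrite edge_symbol_coord eqxx.
Qed.

Lemma edge_symbol_edge t e (c c' : 'I_L) : extremal e -> val c' = (val c).+1 ->
  iET G t (edge_symbol t e c) (edge_symbol t e c').
Proof.
move=> he hc; have : iE G (edge_symbol t e c) (edge_symbol t e c').
  case: hG => _ [_ h _ _]; apply: (h t); rewrite ?edge_symbol_star //.
    by move=> i ne; rewrite !edge_symbol_coord (negbTE ne).
  by rewrite !edge_symbol_coord eqxx.
case/iE_iET => t' h; suff e' : t = t' by rewrite {1}e'.
apply: (cube_edge_inj _ (iET_cube h)); apply/andP; split.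
  by apply/forallP => i; apply/implyP => ne; rewrite !edge_symbol_coord (negbTE ne).
by rewrite !edge_symbol_coord eqxx hc.
Qed.

Lemma edge_symbol_Iside t b e (c : 'I_L) : extremal e ->
  val c = (if b then L.-1 else 0%N) -> edge_symbol t e c \in Iside G t b.
Proof.
move=> he; have hM : (L.-1 < L)%N by lia.
rewrite /Iside; case: b => hc; apply/imsetP.
  by exists (edge_symbol t e c, edge_symbol t e zeroL) => //; apply: edge_symbol_glue.
by exists (edge_symbol t e (Ordinal hM), edge_symbol t e c) => //; apply: edge_symbol_glue.
Qed.

Lemma Ipow_inj m t t' b b' : (1 <= m)%N ->
  Ipow m (Iside G t b) = Ipow m (Iside G t' b') -> (t, b) = (t', b').
Proof.
move=> m1 e; have hM : (L.-1 < L)%N by lia.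
pose ext (c : bool) : 'I_L := if c then Ordinal hM else zeroL.
have vext c : val (ext c) = if c then L.-1 else 0%N by case: c.
have hext c : extremal (ext c) by rewrite /extremal vext; case: c; rewrite eqxx ?orbT.
(* Off direction [t] the coordinates are opposite to [b'], so membership in the face [(t', b')]
   forces [t' = t], and then [b = b']. *)
pose w := [tuple of nseq m (edge_symbol t (ext (~~ b')) (ext b))].
have : w \in Ipow m (Iside G t b).
  rewrite inE; apply/allP => a /nseqP[-> _].
  exact: edge_symbol_Iside (hext _) (vext _).
rewrite e => /Ipow_coord h.
have aw : edge_symbol t (ext (~~ b')) (ext b) \in rev w.
  by rewrite mem_rev; apply/nseqP.
have := h _ aw; rewrite edge_symbol_coord.
case: eqP => [->|_]; rewrite vext; last by case: (b') => /= h'; exfalso; lia.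
by case: (b); case: (b') => //= h'; exfalso; lia.
Qed.

Lemma Ipow_neq0 m t b : Ipow m (Iside G t b) != finset.set0.
Proof.
have hM : (L.-1 < L)%N by lia.
apply/set0Pn; exists [tuple of nseq m
  (edge_symbol t zeroL (if b then Ordinal hM else zeroL))].
rewrite inE; apply/allP => a /nseqP[-> _]; apply: edge_symbol_Iside => //.
by case: b.
Qed.

(* The reversed words along the edge of the cube in direction [t], indexed by
   their global coordinate [n]. *)
Fixpoint edge_word t (m n : nat) : seq (cSym d L s) :=
  if m is m'.+1 then
    edge_symbol t zeroL (Ordinal (ltn_pmod n (ltn_ord zeroL)))
      :: edge_word t m' (n %/ L)
  else [::].

Lemma size_edge_word t m n : size (edge_word t m n) = m.
Proof. by elim: m n => //= m IH n; rewrite IH. Qed.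

Lemma edge_word_edge t m n : (n.+1 < L ^ m)%N ->
  edgeRT G t (edge_word t m n) (edge_word t m n.+1).
Proof.
have L0 : (0 < L)%N by lia.
elim: m n => [|m IH] n hn; first by rewrite expn0 in hn; lia.
have hz : extremal zeroL by rewrite /extremal eqxx.
(* If the last digit of [n] is [L.-1], adding one carries and the step is a gluing edge; otherwise
   only the last letter moves. *)
rewrite /=; have [e|ne] := eqVneq (n %% L)%N L.-1.
  have dvd : (L %| n.+1)%N.
    by rewrite (divn_eq n L) e -addnS prednK // dvdn_add ?dvdn_mull.
  have e1 : (n.+1 %/ L = (n %/ L).+1)%N.
    by rewrite {1}(divn_eq n L) e -addnS prednK // divnMDl // divnn L0 addn1.
  rewrite e1 IH ?edge_symbol_glue ?orbT //=; first exact/eqP.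
  by rewrite -e1 ltn_divLR // -expnSr.
have lt := ltn_pmod n L0; have hm : ((n %% L).+1 < L)%N by lia.
have e1 : (n.+1 %/ L = n %/ L)%N.
  by rewrite {1}(divn_eq n L) -addnS divnMDl // (divn_small hm) addn0.
rewrite e1 eqxx edge_symbol_edge //=.
by rewrite {1}(divn_eq n L) -addnS modnMDl (modn_small hm).
Qed.

Lemma edge_word_first t m a : a \in edge_word t m 0 -> a \in Iside G t false.
Proof.
elim: m => [//|m IH]; rewrite [edge_word _ _ _]/= inE div0n => /predU1P[->|//].
by apply: edge_symbol_Iside; rewrite /= ?mod0n.
Qed.

Lemma edge_word_last t m a : a \in edge_word t m (L ^ m).-1 -> a \in Iside G t true.
Proof.
have L0 : (0 < L)%N by lia.
elim: m => [//|m IH]; rewrite [edge_word _ _ _]/=.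
have -> : ((L ^ m.+1).-1 = (L ^ m).-1 * L + L.-1)%N.
  have : (0 < L ^ m)%N by rewrite expn_gt0 L0.
  by rewrite expnSr; nia.
rewrite divnMDl // divn_small; last by lia.
rewrite addn0 inE => /predU1P[->|//].
by apply: edge_symbol_Iside; rewrite //= modnMDl modn_small //; lia.
Qed.

Lemma edge_word_inS t m n : inS G (edge_word t m n).
Proof.
elim: m n => //= m IH n; rewrite IH andbT.
case: hG => _ [h _ _ _]; apply: (h t); exact: edge_symbol_star.
Qed.

(** The walk along an edge of the cube joins the two faces. This makes the infimum of the energies
    finite. *)
Lemma unit_flow_exists (R : realType) m t : (1 <= m)%N ->
  exists F : m.-tuple (cSym d L s) -> m.-tuple (cSym d L s) -> R,
    is_unit_flow (Gm_edge G m) F (Ipow m (Iside G t false)) (Ipow m (Iside G t true)).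
Proof.
move=> m1; pose w n : m.-tuple (cSym d L s) :=
  rev_tuple (Tuple (introT eqP (size_edge_word t m n))).
have [|F [hF hdiv]] := @path_flow R _ (Gm_edge G m) w (L ^ m).-1.
  move=> n hn; rewrite /undir /Gm_edge /= !revK /inS !all_rev.
  rewrite -!/(inS _ _) !edge_word_inS /=; apply/orP; left.
  by apply/existsP; exists t; apply: edge_word_edge; lia.
have w0 : w 0%N \in Ipow m (Iside G t false).
  by rewrite inE; apply/allP => a; rewrite /= mem_rev; apply: edge_word_first.
have w1 : w (L ^ m).-1 \in Ipow m (Iside G t true).
  by rewrite inE; apply/allP => a; rewrite /= mem_rev; apply: edge_word_last.
exists F; exact: path_unit_flow (Ipow_disjoint t m1) w0 w1 hF hdiv.
Qed.

End Cubical.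

(** * Extension of flows to the augmented graph *)

Section AugmentedGraph.
Context {R : realType} {Sym T : finType} {G : igs Sym T} {m : nat}.
Variables (A : {set m.-tuple Sym}) (F : m.-tuple Sym -> m.-tuple Sym -> R).
Variable nu : m.-tuple Sym -> R.

(* The mass [nu] leaves the graph through the edges towards [tildeL A]. *)
Definition extend_flow (x y : Vt Sym m) : R :=
  match x, y with
  | inl w, inl v => F w v
  | inr p, inl v => if p == (A, v) then - nu v else 0
  | inl w, inr p => if p == (A, w) then nu w else 0
  | inr _, inr _ => 0
  end.

Hypothesis hF : edge_field (Gm_edge G m) F.
Hypothesis hA : A \in Lset G m.
Hypothesis nuA : forall w, nu w != 0 -> w \in A.

Lemma edge_field_extend : edge_field (Gt_edge G m) extend_flow.
Proof.
case: hF => aF sF; split=> [[w|p] [v|p']|[w|[B w]] [v|[B' v]]] //=.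
- by case: ifP; rewrite ?opprK ?oppr0.
- by case: ifP; rewrite ?oppr0.
- by rewrite oppr0.
- exact: sF.
- rewrite /undir /= => h; case: eqP => // -[eB ev]; apply/eqP.
  by apply: contraNT h => /nuA wA; rewrite eB ev eqxx hA wA.
- rewrite /undir /= orbF => h; case: eqP => // -[eB ev]; apply/eqP.
  by rewrite oppr_eq0; apply: contraNT h => /nuA wA; rewrite eB ev eqxx hA wA.
Qed.

Lemma divF_extend_inl w :
  divF (Gt_edge G m) extend_flow (inl w) = divF (Gm_edge G m) F w + nu w.
Proof.
rewrite (divF_total _ edge_field_extend) (divF_total _ hF) big_sumType /=.
by rewrite -[X in _ + X = _]big_mkcond big_pred1_eq.
Qed.

Lemma divF_extend_inr p :
  divF (Gt_edge G m) extend_flow (inr p) = if p.1 == A then - nu p.2 else 0.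
Proof.
rewrite (divF_total _ edge_field_extend) big_sumType /= [X in _ + X]big1 // addr0.
case: p => B w /=; rewrite (bigD1 w) //= big1 ?addr0 => [|v /negbTE ne].
  by rewrite xpair_eqE eqxx andbT.
by rewrite xpair_eqE [w == v]eq_sym ne andbF.
Qed.

Lemma total_energy_extend (q : R) : 0 < q ->
  total_energy q extend_flow = total_energy q F + 2 * \sum_w `|nu w| `^ q.
Proof.
move=> q0; have p0 : `|0 : R| `^ q = 0 by rewrite normr0 powR0 // gt_eqF.
rewrite /total_energy big_sumType /=.
have -> : \sum_w \sum_y `|extend_flow (inl w) y| `^ q =
    \sum_w \sum_v `|F w v| `^ q + \sum_w `|nu w| `^ q.
  rewrite -big_split; apply: eq_bigr => w _; rewrite big_sumType /=; congr (_ + _).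
  rewrite (bigD1 (A, w)) //= eqxx big1 ?addr0 // => p /negbTE ->; exact: p0.
rewrite -addrA; congr (_ + _); rewrite mulr_natl mulr2n; congr (_ + _).
under eq_bigr do rewrite big_sumType /= [X in _ + X]big1 // addr0.
rewrite exchange_big; apply: eq_bigr => w _.
by rewrite (bigD1 (A, w)) //= eqxx normrN big1 ?addr0 // => p /negbTE ->.
Qed.

End AugmentedGraph.

(** * The symmetrised flow and the flow basis *)

Section FlowBasis.
Context {R : realType} {d L s : nat} {G : igs (cSym d L s) 'I_d} {q : R} {m : nat}.
Hypotheses (hs : (1 <= s)%N) (hL : (3 <= L)%N) (hG : is_cubical G).
Hypotheses (q_gt0 : 0 < q) (m_gt0 : (1 <= m)%N).
Variable j : 'I_d.

Let W := m.-tuple (cSym d L s).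
Let E := Gm_edge G m.
Let face (x : 'I_d * bool) : {set W} := Ipow m (Iside G x.1 x.2).
Let eta : W -> W := eta_word (eta_c j).
Let alpha (k : 'I_d) : W -> W := eta_word (alphaP j k).

Variable F0 : W -> W -> R.
Hypothesis hF0 : is_unit_flow E F0 (face (j, false)) (face (j, true)).

Let etaK : involutive eta.
Proof. exact: eta_word_involutive (eta_c_involutive j). Qed.

Let alphaK k : involutive (alpha k).
Proof. exact: eta_word_involutive (alphaP_involutive j k). Qed.

Let eta_face x b : x \in face (j, b) -> eta x \in face (j, ~~ b).
Proof.
by move/(Ipow_map (eta_c_symmetry hG j)); rewrite /face /= eqxx addbT.
Qed.

Let alpha_face k x b : x \in face (j, b) -> alpha k x \in face (k, b).
Proof.
by move/(Ipow_map (alphaP_symmetry hG j k)); rewrite /face /= tpermL addbF.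
Qed.

Let field0 : edge_field E F0.
Proof. by case: hF0 => [[_ []]]. Qed.

Let notin_plus x : x \in face (j, false) -> x \notin face (j, true).
Proof. by move=> xA; rewrite (disjointFr (Ipow_disjoint hL hG j m_gt0)). Qed.

Definition sym_flow (x y : W) : R := 2^-1 * (F0 x y - push eta F0 x y).

(** The divergence of [sym_flow] on the face [(j, -)], extended by zero. *)
Definition source (x : W) : R :=
  if x \in face (j, false) then 2^-1 * (divF E F0 x - divF E F0 (eta x)) else 0.

Let mapE : graph_map E eta.
Proof. exact: (@graph_map_eta_word _ _ _ _ _ _ (eta_c_symmetry hG j)). Qed.

Let mapA k : graph_map E (alpha k).
Proof. exact: (@graph_map_eta_word _ _ _ _ _ _ (alphaP_symmetry hG j k)). Qed.

Let mapF k : graph_map E (fold_word j k (m := m)).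
Proof. exact: graph_map_fold_word. Qed.

Lemma sym_flow_field : edge_field E sym_flow.
Proof. by apply/edge_fieldZ/edge_fieldB => //; apply: edge_field_push. Qed.

Let div0 x : x \notin face (j, false) -> x \notin face (j, true) -> divF E F0 x = 0.
Proof. by case: hF0 => [[_ [_ _ h]] _]; apply: h. Qed.

Let eta_minus x : (eta x \in face (j, false)) = (x \in face (j, true)).
Proof. by apply/idP/idP => /eta_face; rewrite ?etaK. Qed.

Lemma divF_sym_flow x : divF E sym_flow x = source x - source (eta x).
Proof.
rewrite divFZ divFB divF_push // (@sum_fiber_support _ _ eta eta) // /source etaK.
rewrite eta_minus; case: ifP => xA.
  by rewrite (negbTE (notin_plus xA)) subr0.
case: ifP => xB; first lra.
by rewrite !div0 ?eta_minus ?xA ?xB //; [lra|rewrite -eta_minus etaK xA].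
Qed.

Lemma source_sum : \sum_x source x = 1.
Proof.
case: (hF0) => _ hu; rewrite /source -big_mkcond -mulr_sumr sumrB hu.
(* All divergences add up to zero, so those on [(j, +)], the mirror image of [(j, -)], add up to
   [-1]. *)
have hr : \sum_(x in face (j, false)) divF E F0 (eta x) = -1.
  rewrite (reindex_inj (can_inj etaK)) /=; under eq_bigr do rewrite etaK.
  have := sum_divF field0; rewrite (bigID (mem (face (j, false)))) /= hu.
  move/eqP; rewrite addrC addr_eq0 => /eqP <-; rewrite big_mkcond [RHS]big_mkcond.
  apply: eq_bigr => x _; rewrite eta_minus.
  have [xA|xA] := boolP (x \in _); first by rewrite (negbTE (notin_plus xA)).
  by case: ifP => // /negbT xB; rewrite div0.
by rewrite hr; lra.
Qed.

(** On [(j, -)] the mirrored term vanishes and [source] is a divergence, hence a sum over boundedly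
    many neighbours. *)
Lemma source_energy :
  \sum_x `|source x| `^ q <= (d * (s + s))%:R `^ q * total_energy q sym_flow.
Proof.
apply: le_trans (sum_powR_divF_le q_gt0 _ (degree_le hL hG (m := m))).
apply: ler_sum => x _; rewrite divF_sym_flow.
have [xA|xA] := boolP (x \in face (j, false)).
  by rewrite {3}/source eta_minus (negbTE (notin_plus xA)) subr0.
by rewrite /source (negbTE xA) normr0 powR0 ?powR_ge0 // gt_eqF.
Qed.

(** The factor [2 ^ q] comes from the difference, [1 + 4 ^ q] from [F0] and its mirror image, and
    the last [2] from counting ordered pairs. *)
Lemma sym_flow_energy :
  total_energy q sym_flow <= 2 `^ q * (1 + 4 `^ q) * 2 * energy E q F0.
Proof.
apply: le_trans (total_energy_half q_gt0 _) _.
apply: le_trans (total_energyB q_gt0 _ _) _; rewrite -!mulrA ler_wpM2l ?powR_ge0 //.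
apply: (@le_trans _ _ ((1 + 4 `^ q) * total_energy q F0)).
  rewrite mulrDl mul1r lerD2l; apply: (total_energy_push q_gt0 (psi := eta)) => x.
  by rewrite etaK !inE eqxx orbT.
by rewrite ler_wpM2l ?addr_ge0 ?powR_ge0 // total_energy_le.
Qed.

(** The image of [source] under the symmetry taking [(j, -)] to [f]. *)
Definition mass (f : 'I_d * bool) (x : W) : R :=
  source (if f.2 then eta (alpha f.1 x) else alpha f.1 x).

(* A flow from [source] on the face [(j, -)] to [mass f] on the face [f]:
   folding along the diagonal hyperplane [c_j = c_k] moves the sink of
   [sym_flow] from [(j, +)] to [(k, +)], and [alpha k] maps [sym_flow] to a flow
   from [(k, -)] to [(k, +)]. *)
Definition tree_flow (f : 'I_d * bool) (x y : W) : R :=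
  push (fold_word j f.1 (m := m)) sym_flow x y -
  (if f.2 then 0 else push (alpha f.1) sym_flow x y).

Lemma tree_flow_field f : edge_field E (tree_flow f).
Proof.
have hF := sym_flow_field; apply: edge_fieldB; first exact: edge_field_push.
case: f.2; last exact: edge_field_push.
by split=> // x y; rewrite oppr0.
Qed.

(** The folded flow has divergence [source x - source (eta (alpha k x))]. For a minus face,
    subtracting a flow of divergence [source (alpha k x) - source (eta (alpha k x))] replaces the
    sink on [(k, +)] by one on [(k, -)]. *)
Lemma divF_tree_flow f x : divF E (tree_flow f) x = source x - mass f x.
Proof.
case: f => k b; have hF := sym_flow_field.
have supp y : source y != 0 -> y \in face (j, false).
  by rewrite /source; case: ifP; rewrite ?eqxx.
have -> : divF E (tree_flow (k, b)) x =
    divF E (push (fold_word j k (m := m)) sym_flow) x -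
    (if b then 0 else divF E (push (alpha k) sym_flow) x).
  by rewrite divFB; case: b => //; congr (_ - _); rewrite /divF big1.
rewrite divF_push //; under eq_bigr do rewrite divF_sym_flow.
rewrite sumrB (@sum_fiber_support _ _ _ id) //; last first.
  by move=> y /supp; apply: fold_word_minus.
rewrite (@sum_fiber_support _ _ _ (alpha k) (fun y => source (eta y))) //; last first.
  by move=> y /supp; rewrite eta_minus; apply: fold_word_plus.
rewrite /mass /=; case: b; first by rewrite subr0.
rewrite divF_push // (@sum_fiber_support _ _ _ (alpha k)) // divF_sym_flow; lra.
Qed.

Lemma mass_support f x : mass f x != 0 -> x \in face f.
Proof.
case: f => k b; rewrite /mass /source; case: ifP; rewrite ?eqxx //= => + _.
case: b; first by rewrite eta_minus => /(alpha_face k); rewrite alphaK.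
by move/(alpha_face k); rewrite alphaK.
Qed.

Let mass_reindex (h : R -> R) f : \sum_x h (mass f x) = \sum_x h (source x).
Proof.
rewrite /mass; case: f.2; last by rewrite [RHS](reindex_inj (can_inj (alphaK f.1))).
rewrite [RHS](reindex_inj (can_inj etaK)).
by rewrite [RHS](reindex_inj (can_inj (alphaK f.1))).
Qed.

Lemma mass_sum f : \sum_x mass f x = 1.
Proof. by rewrite (mass_reindex id) source_sum. Qed.

Lemma mass_energy f : \sum_x `|mass f x| `^ q = \sum_x `|source x| `^ q.
Proof. exact: (mass_reindex (fun r => `|r| `^ q)). Qed.

(** The swap conjugates the flip of [k] into the flip of [j]. This is the mirror symmetry required
    between opposite faces. *)
Lemma mass_eta k b x : mass (k, ~~ b) (eta_word (eta_c k) x) = mass (k, b) x.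
Proof.
have -> : mass (k, ~~ b) (eta_word (eta_c k) x) =
    source (if ~~ b then eta (eta (alpha k x)) else eta (alpha k x)).
  have e : alpha k (eta_word (eta_c k) x) = eta (alpha k x).
    apply: val_inj; rewrite /= -!map_comp; apply: eq_map => a /=.
    exact: alphaP_eta_c.
  by rewrite /mass /= e.
by rewrite /mass etaK; case: b.
Qed.

Lemma tree_flow_energy f : total_energy q (tree_flow f) <=
  2 `^ q * (2 * 4 `^ q) * total_energy q sym_flow.
Proof.
apply: le_trans (total_energyB q_gt0 _ _) _.
rewrite -!mulrA ler_wpM2l ?powR_ge0 // mulr_natl mulr2n; apply: lerD.
  apply: (total_energy_push q_gt0 (psi := alpha f.1)) => x; exact: fold_word_fiber.
case: f.2; last first.
  apply: (total_energy_push q_gt0 (psi := alpha f.1)) => x.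
  by rewrite alphaK !inE eqxx orbT.
rewrite [leLHS]big1 ?mulr_ge0 ?powR_ge0 ?total_energy_ge0 // => x _.
by rewrite big1 // => y _; rewrite normr0 powR0 // gt_eqF.
Qed.

(** The basis is indexed by sets of words, the flows by pairs of a type and a sign; the default only
    concerns sets outside [Lset]. *)
Let face_of (A : {set W}) : 'I_d * bool := odflt (j, false) [pick f | face f == A].

Let face_ofK A : A \in Lset G m -> face (face_of A) = A.
Proof.
case/imset2P => t b _ _ ->; rewrite /face_of; case: pickP => [f /eqP //|].
by move/(_ (t, b)); rewrite eqxx.
Qed.

Let faceK f : face_of (face f) = f.
Proof.
rewrite /face_of; case: pickP => [[t b] /eqP|/(_ f)]; last by rewrite eqxx.
by case: f => t' b' /(Ipow_inj hL hG hs m_gt0).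
Qed.

(** On [W] its divergence is [source] for every [A] in [Lset], so it cancels in differences and only
    the masses on the added vertices remain. *)
Definition potential (A : {set W}) : Vt (cSym d L s) m -> Vt (cSym d L s) m -> R :=
  extend_flow A (tree_flow (face_of A)) (mass (face_of A)).

Definition basis_flow (A B : {set W}) (x y : Vt (cSym d L s) m) : R :=
  potential B x y - potential A x y.

Let supp A (hA : A \in Lset G m) w : mass (face_of A) w != 0 -> w \in A.
Proof. by move/mass_support; rewrite face_ofK. Qed.

Let potential_field A : A \in Lset G m -> edge_field (Gt_edge G m) (potential A).
Proof.
by move=> hA; apply: edge_field_extend (tree_flow_field _) hA (supp hA).
Qed.

Let div_inl A w : A \in Lset G m ->
  divF (Gt_edge G m) (potential A) (inl w) = source w.
Proof.
move=> hA; rewrite (divF_extend_inl (tree_flow_field _) hA (supp hA)).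
by rewrite divF_tree_flow subrK.
Qed.

Let div_inr A p : A \in Lset G m -> divF (Gt_edge G m) (potential A) (inr p) =
  if p.1 == A then - mass (face_of A) p.2 else 0.
Proof.
by move=> hA; rewrite (divF_extend_inr (tree_flow_field _) hA (supp hA)).
Qed.

Lemma basis_flow_unit A B : A \in Lset G m -> B \in Lset G m -> A != B ->
  is_unit_flow (Gt_edge G m) (basis_flow A B) (tildeL A) (tildeL B).
Proof.
move=> hA hB AB; have [aF sF] := edge_fieldB (potential_field hB) (potential_field hA).
have ne0 C : C \in Lset G m -> tildeL C != finset.set0.
  case/imset2P => t b _ _ ->; have /set0Pn[w hw] := Ipow_neq0 hL hG hs m t b.
  by apply/set0Pn; exists (inr (Ipow m (Iside G t b), w)); apply/imsetP; exists w.
split.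
  split; split=> //; [exact: ne0|exact: ne0| |].
    rewrite disjoint_subset; apply/fintype.subsetP => _ /imsetP[w _ ->].
    by apply/negP => /imsetP[v _ [eAB _]]; rewrite eAB eqxx in AB.
  move=> [w|[C w]] hxA hxB; rewrite divFB; first by rewrite !div_inl ?subrr.
  have out D : D \in Lset G m -> (inr (C, w) : Vt _ m) \notin tildeL D ->
      divF (Gt_edge G m) (potential D) (inr (C, w)) = 0.
    move=> hD hn; rewrite div_inr //=; case: eqP => // eCD; apply/eqP.
    rewrite oppr_eq0; apply: contraNT hn => /(supp hD) wD.
    by rewrite eCD; apply/imsetP; exists w.
  by rewrite !out ?subrr.
rewrite big_imset /=; last by move=> w v _ _ [].
rewrite -(mass_sum (face_of A)) [RHS](bigID (mem A)) /= [X in _ + X]big1 ?addr0.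
  apply: eq_bigr => w _; rewrite divFB !div_inr //= eqxx (negbTE AB).
  by rewrite sub0r opprK.
by move=> w wA; apply/eqP; apply: contraNT wA => /(supp hA).
Qed.

(** On the edges towards [tildeL A] every potential except that of [A] vanishes, so the values there
    do not depend on the other face. *)
Lemma basis_flow_basis : is_flow_basis G (fun t => eta_c t) basis_flow.
Proof.
have pne A B w : B != A -> potential A (inr (B, w)) (inl w) = 0.
  by move=> ne; rewrite /= xpair_eqE (negbTE ne).
have pne' A B w : B != A -> potential A (inl w) (inr (B, w)) = 0.
  by move=> ne; rewrite /= xpair_eqE (negbTE ne).
split.
- exact: basis_flow_unit.
- by move=> A B C _ _ _ _ CA CB w _; rewrite /basis_flow !pne ?subrr.
- move=> A B C _ _ _ CA CB w _.
  by rewrite /basis_flow (pne A) // (pne B) // (pne' A) // (pne' B).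
(* Only the potential of the face met by each edge survives, which leaves values of [mass] at [v]
   and at its mirror image. *)
move=> t b /= ne v _.
have nes : Ipow m (Iside G t (~~ b)) != Ipow m (Iside G t b) by rewrite eq_sym.
rewrite /basis_flow (pne _ _ v ne) (pne' _ _ _ nes) (pne' _ _ v ne).
rewrite !subr0 sub0r /= !eqxx opprK.
rewrite -[Ipow m (Iside G t b)]/(face (t, b)).
rewrite -[Ipow m (Iside G t (~~ b))]/(face (t, ~~ b)) !faceK.
by rewrite mass_eta.
Qed.

(** A potential costs its tree flow plus the added edges, each counted in both orders; the remaining
    factors come from the difference of two potentials and from [sym_flow_energy]. *)
Lemma basis_flow_energy A B :
  energy (Gt_edge G m) q (basis_flow A B) <=
  2 `^ q * (2 * (2 `^ q * (2 * 4 `^ q) + 2 * (d * (s + s))%:R `^ q)) *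
    (2 `^ q * (1 + 4 `^ q) * 2) * energy E q F0.
Proof.
have hpot C : total_energy q (potential C) <=
    (2 `^ q * (2 * 4 `^ q) + 2 * (d * (s + s))%:R `^ q) * total_energy q sym_flow.
  rewrite total_energy_extend // [leRHS]mulrDl mass_energy.
  apply: lerD; first exact: tree_flow_energy.
  by rewrite -mulrA ler_pM2l // source_energy.
apply: le_trans (energy_le_total _ _) _.
apply: le_trans (total_energyB q_gt0 _ _) _.
rewrite -!mulrA ler_wpM2l ?powR_ge0 //.
apply: le_trans (lerD (hpot _) (hpot _)) _.
have -> (r : R) : r + r = 2 * r by lra.
rewrite ler_pM2l // ler_wpM2l ?addr_ge0 ?mulr_ge0 ?powR_ge0 //.
by apply: le_trans sym_flow_energy _; rewrite -!mulrA.
Qed.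

End FlowBasis.

Theorem theorem6p12 (R : realType) (d L s : nat)
  (hd : (1 <= d)%N) (hs : (1 <= s)%N) (hL : (3 <= L)%N)
  (G : igs (cSym d L s) 'I_d) (hG : is_cubical G)
  (p : R) (hp : 1 < p) :
  let q := p / (p - 1) in
  exists CFB : R, 0 < CFB /\
    forall m : nat, (1 <= m)%N ->
      exists FB : {set m.-tuple (cSym d L s)} -> {set m.-tuple (cSym d L s)} ->
                  Vt (cSym d L s) m -> Vt (cSym d L s) m -> R,
        is_flow_basis G (fun j => eta_c j) FB /\
        forall t : 'I_d,
          ((energy_FB G q FB)%:E <=
             CFB%:E * Eq_inf (Gm_edge G m) q
                        (Ipow m (Iside G t false)) (Ipow m (Iside G t true)))%E.
Proof.
move=> q; have q0 : 0 < q by rewrite divr_gt0 ?subr_gt0 // (lt_trans ltr01).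
pose C : R := 2 `^ q * (2 * (2 `^ q * (2 * 4 `^ q) + 2 * (d * (s + s))%:R `^ q)) *
  (2 `^ q * (1 + 4 `^ q) * 2).
have C0 : 0 < C by rewrite !mulr_gt0.
(* The extra [2] pays for using a nearly optimal flow. *)
exists (C * 2); split; first by rewrite mulr_gt0.
move=> m m0; pose e t := Eq_inf (Gm_edge G m) q
  (Ipow m (Iside G t false)) (Ipow m (Iside G t true)).
have [j _ jmin] := @arg_minP _ _ _ (Ordinal hd) xpredT e isT.
have [F hF hE] := near_optimal_flow q0 (unit_flow_exists hL hG hs R j m0).
exists (basis_flow (G := G) j F); split; first exact: basis_flow_basis.
move=> t; apply: (@le_trans _ _ (C * energy (Gm_edge G m) q F)%:E).
  rewrite lee_fin; apply: bigmax_le; last first.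
    by move=> [A B] _; apply: basis_flow_energy.
  rewrite mulr_ge0 ?(ltW C0) //; apply: sumr_ge0 => ? _; exact: powR_ge0.
rewrite EFinM (EFinM C 2) -muleA lee_pmul2l ?lte_fin ?fin_numE //.
apply: le_trans hE _; rewrite lee_pmul2l ?lte_fin //; exact: jmin.
Qed.
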